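(* Let $n,p\in\mathbb{N}$, $\epsilon>0$, and $\delta=o(\frac1n)$. For every $(\epsilon,\delta)$-differentially private algorithm which takes data sets of size $n$ with entries in $\{-\frac{1}{\sqrt p},\frac{1}{\sqrt p}\}^p$ and whose output, denoted $\theta^{priv}$, lies in the Euclidean unit ball $\mathbb{B}\subset\mathbb{R}^p$, there is a data set $\mathcal{D}=\{d_1,\dots,d_n\}\subseteq\{-\frac{1}{\sqrt p},\frac{1}{\sqrt p}\}^p$ such that, with probability at least $1/3$ over the algorithm's random coins, $$\mathcal{L}(\theta^{priv};\mathcal{D})-\mathcal{L}(\theta^*;\mathcal{D})=\Omega\left(\min\left(n,\frac{p}{\epsilon^2n}\right)\right),$$ where $\mathcal{L}(\theta;\mathcal{D})=\frac12\sum_{i=1}^n\|\theta-d_i\|_2^2$ for $\theta\in\mathbb{B}$, and $\theta^*=\frac1n\sum_{i=1}^nd_i$ is the minimizer of $\mathcal{L}(\cdot;\mathcal{D})$ over $\mathbb{B}$.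
   Context: $\Omega(\cdot)$ hides an absolute positive multiplicative constant; $\delta=\delta(n)$ is a function of $n$ with $n\delta(n)\to0$. Data sets are multisets (entries may repeat). Differential privacy: two data sets of size $n$ are neighbors if they differ in one entry. A randomized algorithm $\mathcal{A}$ is $(\epsilon,\delta)$-differentially private if for all neighboring $\mathcal{D},\mathcal{D}'$ and all events $S$ in the output space, $\Pr(\mathcal{A}(\mathcal{D})\in S)\le e^{\epsilon}\Pr(\mathcal{A}(\mathcal{D}')\in S)+\delta$.
   Formalization: The formal theorem also assumes ε ≤ max(1, c·p), with c the absolute constant hidden in Ω, and n large depending on δ(·); for unrestricted ε the claim is false (p=1, ε=10, truncated geometric noise returns the exact mean with probability > 2/3). *)

(* Defs.v *)
From HB Require Import structures.
From mathcomp Require Import all_boot all_order all_algebra.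
From mathcomp Require Import finmap multiset.
From mathcomp Require Import all_classical all_reals all_analysis.
From mathcomp Require Import ring lra.
Set Implicit Arguments.
Unset Strict Implicit.
Unset Printing Implicit Defensive.
Import Order.TTheory GRing.Theory Num.Theory.
Import numFieldNormedType.Exports.
Local Open Scope classical_set_scope.
Local Open Scope mset_scope.
Local Open Scope ring_scope.

(* The library's norm on row vectors is the sup norm. *)
Definition norm2 (R : realType) (p : nat) (v : 'rV[R]_p) : R :=
  Num.sqrt (\sum_(j < p) v ord0 j ^+ 2).

Definition unit_ball2 (R : realType) (p : nat) : set 'rV[R]_p :=
  [set v | norm2 v <= 1].

Definition hypercube (R : realType) (p : nat) : set 'rV[R]_p :=
  [set d | forall j, d ord0 j = - (Num.sqrt p%:R)^-1
                  \/ d ord0 j = (Num.sqrt p%:R)^-1].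

Definition dataset (R : realType) (n p : nat) : set {mset 'rV[R]_p} :=
  [set D | size D = n /\ forall d, d \in D -> hypercube d].

Definition neighbors (T : choiceType) (D D' : {mset T}) : Prop :=
  exists (E : {mset T}) (x y : T),
    [/\ x != y, D = x +` E & D' = y +` E].

(* R^p with its Borel sigma-algebra. *)
Definition borel_rV (R : realType) (p : nat) :=
  g_sigma_algebraType [set U : set 'rV[R]_p | open U].

(* A randomized algorithm maps a data set to the law of its output.  Its value
   on multisets that are not data sets of size n is irrelevant. *)
Definition algorithm (R : realType) (p : nat) :=
  {mset 'rV[R]_p} -> probability (borel_rV R p) R.

Definition differentially_private (R : realType) (n p : nat) (eps delta : R)
    (A : algorithm R p) : Prop :=
  forall D D' : {mset 'rV[R]_p}, dataset n D -> dataset n D' ->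
  neighbors D D' ->
  forall S : set (borel_rV R p), measurable S ->
  (A D S <= (expR eps)%:E * A D' S + delta%:E)%E.

Definition loss (R : realType) (p : nat) (D : {mset 'rV[R]_p})
    (theta : 'rV[R]_p) : R :=
  2^-1 * \sum_(d <- D) norm2 (theta - d) ^+ 2.

Definition mean (R : realType) (p : nat) (D : {mset 'rV[R]_p}) : 'rV[R]_p :=
  (size D)%:R^-1 *: \sum_(d <- D) d.

Lemma norm2_sqr (R : realType) (p : nat) (v : 'rV[R]_p) :
  norm2 v ^+ 2 = \sum_(j < p) v ord0 j ^+ 2.
Proof. by rewrite sqr_sqrtr// sumr_ge0// => j _; rewrite sqr_ge0. Qed.

Lemma unit_ball2E (R : realType) (p : nat) (v : 'rV[R]_p) :
  (norm2 v <= 1) = (\sum_(j < p) v ord0 j ^+ 2 <= 1).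
Proof. by rewrite -norm2_sqr expr_le1// sqrtr_ge0. Qed.

Lemma hypercube_sum_sqr (R : realType) (p : nat) (d : 'rV[R]_p) :
  hypercube d -> \sum_(j < p) d ord0 j ^+ 2 <= 1.
Proof.
case: p d => [|p] d hd; first by rewrite big_ord0.
rewrite (eq_bigr (fun=> p.+1%:R^-1)) => [|j _].
  by rewrite sumr_const card_ord -[_ *+ _]mulr_natl mulfV// pnatr_eq0.
have -> : d ord0 j ^+ 2 = ((Num.sqrt p.+1%:R)^-1) ^+ 2.
  by case: (hd j) => -> //; rewrite sqrrN.
by rewrite exprVn sqr_sqrtr.
Qed.

Lemma loss_mean (R : realType) (p : nat) (D : {mset 'rV[R]_p})
    (theta : 'rV[R]_p) :
  loss D theta = loss D (mean D) +
    2^-1 * (size D)%:R * norm2 (theta - mean D) ^+ 2.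
Proof.
rewrite /loss -mulrA -mulrDr; congr (_ * _).
rewrite norm2_sqr.
under eq_bigr do rewrite norm2_sqr.
under [in RHS]eq_bigr do rewrite norm2_sqr.
rewrite exchange_big /= [in RHS]exchange_big /= mulr_sumr -big_split /=.
apply: eq_bigr => j _.
have [D0|D0] := eqVneq (size D) 0%N.
  by rewrite (size0nil D0) !big_nil mul0r addr0.
have sE (s : seq 'rV[R]_p) (t : R) : \sum_(d <- s) (t - d ord0 j) ^+ 2 =
    (size s)%:R * t ^+ 2 - 2 * t * (\sum_(d <- s) d ord0 j)
    + \sum_(d <- s) d ord0 j ^+ 2.
  elim: s => [|d s ih]; first by rewrite !big_nil /=; ring.
  by rewrite !big_cons ih /= -[(size s).+1]addn1 natrD; ring.
have cE (t : 'rV[R]_p) : \sum_(d <- D) (t - d) ord0 j ^+ 2 =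
    \sum_(d <- D) (t ord0 j - d ord0 j) ^+ 2.
  by apply: eq_bigr => d _; rewrite !mxE.
rewrite !cE !sE.
have -> : (theta - mean D) ord0 j = theta ord0 j - mean D ord0 j.
  by rewrite !mxE.
rewrite /mean mxE summxE.
have : (size D)%:R != 0 :> R by rewrite pnatr_eq0.
set S := \sum_(d <- D) d ord0 j; set m := (size D)%:R => m0.
by field.
Qed.

Lemma mean_unit_ball2 (R : realType) (n p : nat) (D : {mset 'rV[R]_p}) :
  dataset n D -> unit_ball2 (mean D).
Proof.
move=> [_ Dcube]; rewrite /unit_ball2 /= unit_ball2E.
have [D0|D0] := eqVneq (size D) 0%N.
  rewrite big1// => j _.
  by rewrite /mean (size0nil D0) big_nil scaler0 mxE expr0n.
have n0 : 0 < (size D)%:R :> R by rewrite ltr0n lt0n.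
have norm2N (v : 'rV[R]_p) : norm2 (0 - v) ^+ 2 = norm2 v ^+ 2.
  by rewrite !norm2_sqr; apply: eq_bigr => j _; rewrite !mxE sub0r sqrrN.
have h : \sum_(d <- D) norm2 d ^+ 2 <= (size D)%:R.
  have -> : (size D)%:R = \sum_(d <- D) 1 :> R.
    by rewrite big_const_seq count_predT iter_addr_0.
  rewrite big_seq [leRHS]big_seq; apply: ler_sum => d /Dcube dc.
  by rewrite norm2_sqr hypercube_sum_sqr.
have := loss_mean D 0; rewrite /loss.
under eq_bigr do rewrite norm2N.
rewrite norm2N -norm2_sqr => e.
have k : 0 <= \sum_(d <- D) norm2 (mean D - d) ^+ 2.
  by apply: sumr_ge0 => d _; exact: sqr_ge0.
rewrite -(ler_pM2l n0) mulr1; nra.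
Qed.

Lemma mean_minimizes_loss (R : realType) (p : nat) (D : {mset 'rV[R]_p})
    (theta : 'rV[R]_p) : loss D (mean D) <= loss D theta.
Proof.
by rewrite [leRHS]loss_mean lerDl mulr_ge0// ?sqr_ge0// mulr_ge0// invr_ge0.
Qed.

(* Main.v *)
Require Import Defs.
From HB Require Import structures.
From mathcomp Require Import all_boot all_order all_algebra perm.
From mathcomp Require Import finmap multiset.
From mathcomp Require Import all_classical all_reals all_analysis.
From mathcomp Require Import ring lra zify.
Set Implicit Arguments.
Unset Strict Implicit.
Unset Printing Implicit Defensive.
Import Order.TTheory GRing.Theory Num.Theory.
Import numFieldNormedType.Exports.
Local Open Scope classical_set_scope.
Local Open Scope mset_scope.
Local Open Scope ring_scope.

(* Suppose that on every data set the mechanism is accurate with probability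
   above 2/3.

   If p is small (then eps <= 1), three data sets at Hamming distance about
   1/eps from each other already give a contradiction.

   If p is large, take k of order sqrt(p) rows, each repeated about 1/eps times
   (if eps >= 1, take k of order max(1, sqrt(p)/eps) rows without repetition),
   pad with a fixed row, and keep only the vector v of signs of the output.
   Columns are drawn independently from the exchangeable Bernoulli law with
   uniform bias.  By Laplace's rule of succession the expectation of
   \sum_i <v, y_i - y_0>, with y_0 a fresh row, is proportional to that of
   <v, mean of the rows>, hence at least p/3 by accuracy; restricting to the
   accurate outputs makes the failure event harmless.  On the other hand, by
   privacy each summand is distributed almost as if row i had not been seen, and
   then it is sub-Gaussian with variance O(p), so its positive part has
   expectation O(sqrt(eps p)) + O(p delta) even for eps >= 1.  For small
   constants in the choice of k the sum stays below p/3. *)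

(** * Laplace's rule of succession *)

Definition pm (R : realType) (b : bool) : R := if b then 1 else -1.

Lemma pmM (R : realType) (b : bool) : pm R b * pm R b = 1.
Proof. by case: b; rewrite /pm ?mulrNN mulr1. Qed.

Lemma normr_pm (R : realType) (b : bool) : `|pm R b| = 1.
Proof. by case: b; rewrite /pm ?normrN normr1. Qed.

Lemma pmE (R : realType) (b : bool) : pm R b = 2 * b%:R - 1.
Proof. by case: b => /=; rewrite /pm; ring. Qed.

Definition col_count k p (X : 'M[bool]_(k, p)) (j : 'I_p) : nat :=
  (\sum_i X i j)%N.

Lemma col_count_le k p (X : 'M[bool]_(k, p)) j : (col_count X j <= k)%N.
Proof.
rewrite -[leqRHS]card_ord -sum1_card; apply: leq_sum => i _.
by case: (X i j).
Qed.

Definition col_sum (R : realType) k p (X : 'M[bool]_(k, p)) (j : 'I_p) : R :=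
  \sum_i pm R (X i j).

Lemma col_sumE (R : realType) k p (X : 'M[bool]_(k, p)) j :
  col_sum R X j = 2 * (col_count X j)%:R - k%:R.
Proof.
rewrite /col_sum; under eq_bigr do rewrite pmE.
by rewrite sumrB -mulr_sumr -natr_sum sumr_const card_ord.
Qed.

(* Up to normalisation, each column of a k-row matrix is drawn from the
   exchangeable Bernoulli law with uniformly distributed bias. *)
Definition laplace_weight (R : realType) k p (X : 'M[bool]_(k, p)) : R :=
  \prod_j ((col_count X j)`! * (k - col_count X j)`!)%:R.

Lemma laplace_weight_gt0 (R : realType) k p (X : 'M[bool]_(k, p)) :
  0 < laplace_weight R X.
Proof. by apply: prodr_gt0 => j _; rewrite ltr0n muln_gt0 !fact_gt0. Qed.

Definition perm_cols k p (s : 'I_p -> 'S_k) (X : 'M[bool]_(k, p)) :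
    'M[bool]_(k, p) := \matrix_(i, j) X (s j i) j.

(** Exchangeability: each factor sees its column only through the number of [true] entries, so rows
    may be permuted separately in each column. *)
Lemma laplace_weight_perm_cols (R : realType) k p (s : 'I_p -> 'S_k)
    (X : 'M[bool]_(k, p)) :
  laplace_weight R (perm_cols s X) = laplace_weight R X.
Proof.
apply: eq_bigr => j _; suff -> : col_count (perm_cols s X) j = col_count X j.
  by [].
rewrite /col_count [RHS](reindex_inj (@perm_inj _ (s j))) /=.
by apply: eq_bigr => i _; rewrite mxE.
Qed.

Lemma sum_perm_cols (R : realType) k p (s : 'I_p -> 'S_k)
    (F : 'M[bool]_(k, p) -> R) :
  \sum_X F (perm_cols s X) = \sum_X F X.
Proof.
rewrite [RHS](reindex (perm_cols s)) //=.
exists (perm_cols (fun j => (s j)^-1)%g) => X _; apply/matrixP => i j;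
  by rewrite !mxE ?permK ?permKV.
Qed.

Lemma sum_laplace_weight_perm_cols (R : realType) k p (s : 'I_p -> 'S_k)
    (F : 'M[bool]_(k, p) -> R) :
  \sum_X laplace_weight R X * F (perm_cols s X) =
  \sum_X laplace_weight R X * F X.
Proof.
rewrite -[RHS](sum_perm_cols s); apply: eq_bigr => X _.
by rewrite laplace_weight_perm_cols.
Qed.

Definition flip_entry k p (i0 : 'I_k) (j0 : 'I_p) (X : 'M[bool]_(k, p)) :
    'M[bool]_(k, p) := \matrix_(i, j) (X i j (+) ((i == i0) && (j == j0))).

Lemma flip_entryK k p (i0 : 'I_k) (j0 : 'I_p) :
  involutive (flip_entry i0 j0).
Proof. by move=> X; apply/matrixP => i j; rewrite !mxE addbK. Qed.

Lemma col_count_recl k p (X : 'M[bool]_(k.+1, p)) j :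
  col_count X j = (X ord0 j + col_count (row' ord0 X) j)%N.
Proof.
rewrite /col_count big_ord_recl; congr addn.
by apply: eq_bigr => i _; rewrite mxE.
Qed.

(* Laplace's rule of succession: given the other k rows, the entry of row 0
   in column j has conditional mean [col_sum / (k + 2)]. *)
Lemma laplace_succession (R : realType) k p (f : 'M[bool]_(k, p) -> R)
    (j : 'I_p) :
  \sum_(X : 'M[bool]_(k.+1, p)) laplace_weight R X *
    (f (row' ord0 X) * (k.+2%:R * pm R (X ord0 j) - col_sum R (row' ord0 X) j))
  = 0.
Proof.
pose F (X : 'M[bool]_(k.+1, p)) := laplace_weight R X *
  (f (row' ord0 X) * (k.+2%:R * pm R (X ord0 j) - col_sum R (row' ord0 X) j)).
rewrite -[LHS]/(\sum_X F X).
(* Let t be the count of column j over the other k rows. The weights with entry [true] and [false]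
   are in ratio t + 1 to k - t + 1, while the brackets are 2(k - t + 1) and -2(t + 1), so the paired
   terms cancel. *)
have flipE (X : 'M[bool]_(k.+1, p)) : F X + F (flip_entry ord0 j X) = 0.
  set X' := flip_entry _ _ _.
  have rE : row' ord0 X' = row' ord0 X.
    by apply/matrixP => i l; rewrite !mxE eq_sym (negbTE (neq_lift _ _)) addbF.
  have x0E : X' ord0 j = ~~ X ord0 j by rewrite mxE !eqxx addbT.
  have wE (Y : 'M[bool]_(k.+1, p)) : laplace_weight R Y =
      ((col_count Y j)`! * (k.+1 - col_count Y j)`!)%:R *
      \prod_(l | l != j) ((col_count Y l)`! * (k.+1 - col_count Y l)`!)%:R.
    by rewrite /laplace_weight (bigD1 j).
  rewrite /F rE x0E !wE.
  rewrite [X in _ + _ * X * _](eq_bigr (fun l =>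
    ((col_count X l)`! * (k.+1 - col_count X l)`!)%:R)) => [|l lj]; last first.
    by rewrite !col_count_recl rE /X' mxE (negbTE lj) andbF addbF.
  rewrite !col_count_recl rE x0E col_sumE.
  set t := col_count _ _; have tk : (t <= k)%N := col_count_le _ _.
  move: (f _) (\prod_(l | _) _) => a b.
  have -> : k.+2%:R = k%:R + 2 :> R by rewrite -addn2 natrD.
  have Et : (k - t)%:R = k%:R - t%:R :> R by rewrite natrB.
  have [e1 e0] : ((true + t)`! * (k.+1 - (true + t))`!)%:R
      = (t%:R + 1) * (t`!%:R * (k - t)`!%:R) :> R /\
      ((false + t)`! * (k.+1 - (false + t))`!)%:R
      = (k%:R - t%:R + 1) * (t`!%:R * (k - t)`!%:R) :> R.
    rewrite add0n add1n subSS subSn // !factS !natrM -!natr1 Et.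
    by split; ring.
  by case: (X ord0 j); rewrite e0 e1 /pm /=; ring.
have : \sum_X F X + \sum_X F X = 0.
  rewrite [X in _ + X](reindex_inj (inv_inj (flip_entryK ord0 j))) -big_split.
  by apply: big1 => X _; exact: flipE.
by move=> /eqP; rewrite -mulr2n mulrn_eq0 => /eqP.
Qed.

(** Two distinct entries of a column have correlation 1/3, whence k + k(k - 1)/3. The value 1/3
    follows from the rule of succession and exchangeability, with no evaluation of factorials. *)
Lemma sum_laplace_weight_col_sum_sqr (R : realType) k p (j : 'I_p) :
  \sum_(X : 'M[bool]_(k.+1, p)) laplace_weight R X *
    col_sum R (row' ord0 X) j ^+ 2
  = k%:R * k.+2%:R / 3 * \sum_(X : 'M[bool]_(k.+1, p)) laplace_weight R X.
Proof.
set M := \sum_X laplace_weight R X.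
pose c (i l : 'I_k.+1) := \sum_(X : 'M[bool]_(k.+1, p)) laplace_weight R X *
  (pm R (X i j) * pm R (X l j)).
have cii i : c i i = M by apply: eq_bigr => X _; rewrite pmM mulr1.
have cE i l : l != ord0 -> i != l -> c i l = c i ord0 \/ i = ord0.
  move=> l0 il; have [->|i0] := eqVneq i ord0; [by right|left].
  rewrite /c -(sum_laplace_weight_perm_cols (fun=> tperm ord0 l)).
  by apply: eq_bigr => X _; rewrite !mxE tpermR tpermD // eq_sym.
have succ (i : 'I_k) : k.+2%:R * c (lift ord0 i) ord0 =
    \sum_(X : 'M[bool]_(k.+1, p)) laplace_weight R X *
      (pm R (X (lift ord0 i) j) * col_sum R (row' ord0 X) j).
  have := laplace_succession (fun Y : 'M[bool]_(k, p) => pm R (Y i j)) j.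
  rewrite (eq_bigr (fun X : 'M[bool]_(k.+1, p) => k.+2%:R *
    (laplace_weight R X * (pm R (X (lift ord0 i) j) * pm R (X ord0 j))) -
    laplace_weight R X * (pm R (X (lift ord0 i) j) * col_sum R (row' ord0 X) j)
    )) => [|X _]; last by rewrite mxE; ring.
  by rewrite sumrB -mulr_sumr => /eqP; rewrite subr_eq0 => /eqP.
(* Expanding the column sum in [succ] gives (k + 2) c = M + (k - 1) c. *)
have ci0 (i : 'I_k) : 3 * c (lift ord0 i) ord0 = M.
  have := succ i.
  rewrite (eq_bigr (fun X : 'M[bool]_(k.+1, p) => \sum_l laplace_weight R X *
    (pm R (X (lift ord0 i) j) * pm R (X (lift ord0 l) j)))); last first.
    move=> X _; rewrite /col_sum -mulr_sumr -mulr_sumr; congr (_ * (_ * _)).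
    by apply: eq_bigr => l _; rewrite mxE.
  rewrite exchange_big /= (bigD1 i) //= -/(c _ _) cii.
  rewrite (eq_bigr (fun=> c (lift ord0 i) ord0)) => [|l li]; last first.
    have [] := cE (lift ord0 i) (lift ord0 l) => //.
    by apply: contra_neq li => /lift_inj.
  rewrite sumr_const cardC1 card_ord -mulr_natl.
  have -> : k.+2%:R = k.-1%:R + 3 :> R.
    by rewrite -natrD addn3 prednK // (leq_ltn_trans _ (ltn_ord i)).
  by move=> h; lra.
rewrite (eq_bigr (fun X : 'M[bool]_(k.+1, p) => \sum_i laplace_weight R X *
    (pm R (X (lift ord0 i) j) * col_sum R (row' ord0 X) j))); last first.
  move=> X _; rewrite expr2 -mulr_sumr; congr (_ * _).
  by rewrite -mulr_suml; congr (_ * _); apply: eq_bigr => l _; rewrite mxE.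
rewrite exchange_big /=.
rewrite (eq_bigr (fun=> k.+2%:R * (M / 3))) => [|i _].
  by rewrite sumr_const card_ord -mulr_natl; ring.
by rewrite -succ -(ci0 i); field.
Qed.

(** * Fingerprinting for finite mechanisms *)

(** The worst event is S = {P > e P'}: on it g is at most B, and off it P - e P' is nonpositive. *)
Lemma dp_expectation (R : realType) (V : finType) (P P' g : V -> R)
    (e d B : R) :
  (forall S : {set V}, \sum_(v in S) P v <= e * (\sum_(v in S) P' v) + d) ->
  0 <= B -> (forall v, 0 <= g v <= B) ->
  \sum_v P v * g v <= e * (\sum_v P' v * g v) + d * B.
Proof.
move=> dp B0 gB; pose S := [set v | e * P' v < P v]%SET.
have := dp S; rewrite -lerBlDl => /(ler_wpM2r B0) h.
rewrite -lerBlDl; apply: le_trans h; rewrite !mulr_sumr -!sumrB mulr_suml.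
rewrite [leRHS]big_mkcond /=; apply: ler_sum => v _.
have /andP[g0 gle] := gB v.
rewrite mulrA -mulrBl inE; case: ltP => h.
  by rewrite ler_wpM2l // subr_ge0 ltW.
by rewrite mulr_le0_ge0 // subr_le0.
Qed.

(** From exp(-x) >= 1 - x follows (1 - x) exp(x) <= 1, and (1 - x)(1 + x + 2x^2) exceeds 1 by x^2 (1
    - 2x). *)
Lemma expR_le_quadratic (R : realType) (x : R) :
  x <= 2^-1 -> expR x <= 1 + x + 2 * x ^+ 2.
Proof.
move=> x2; have := expR_ge1Dx (- x); have := expR_gt0 x.
rewrite expRN => e0 h.
have h1 : (1 - x) * expR x <= 1.
  by rewrite -[leRHS](mulVf (lt0r_neq0 e0)) ler_wpM2r // ltW.
have h2 : 0 <= x ^+ 2 * (1 - 2 * x) by rewrite mulr_ge0 ?sqr_ge0 //; lra.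
have x1 : 0 < 1 - x by lra.
rewrite -(ler_pM2l x1); apply: le_trans h1 _; rewrite -subr_ge0.
by apply: le_trans h2 _; rewrite le_eqVlt; apply/orP; left; apply/eqP; ring.
Qed.

Lemma expR_even_le (R : realType) (x : R) :
  `|x| <= 2^-1 -> expR x + expR (- x) <= 2 * expR (2 * x ^+ 2).
Proof.
rewrite ler_norml => /andP[x1 x2].
have := expR_le_quadratic x2; have := @expR_le_quadratic R (- x).
have := expR_ge1Dx (2 * x ^+ 2).
by rewrite sqrrN => h1 /(_ ltac:(lra)) h2 h3; lra.
Qed.

Lemma rademacher_mgf (R : realType) p (a : 'I_p -> R) (B : R) :
  B <= 2^-1 -> (forall j, `|a j| <= B) ->
  \sum_(b : {ffun 'I_p -> bool}) expR (\sum_j pm R (b j) * a j) <=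
  2 ^+ p * expR (2 * p%:R * B ^+ 2).
Proof.
move=> B2 aB.
under eq_bigr do rewrite expR_sum.
rewrite -(bigA_distr_bigA (fun j c => expR (pm R c * a j))) /=.
have -> : 2 ^+ p * expR (2 * p%:R * B ^+ 2) =
    \prod_(j < p) (2 * expR (2 * B ^+ 2)).
  rewrite prodr_const card_ord exprMn -expRM_natl; congr (_ * expR _); ring.
apply: ler_prod => j _; rewrite big_bool /= mul1r mulN1r.
rewrite addr_ge0 ?expR_ge0 //=; apply: le_trans (expR_even_le _) _.
  exact: le_trans (aB j) B2.
rewrite ler_pM2l // ler_expR ler_pM2l // -real_normK ?num_real //.
by rewrite ler_sqr ?nnegrE //; apply: le_trans (aB j).
Qed.

(** Row 0 of [X] is the fresh row, never shown to the mechanism, whose input is [row' ord0 X]; row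
    [i] of the input is therefore row [lift ord0 i] of [X]. *)
Definition score (R : realType) k p (i : 'I_k) (X : 'M[bool]_(k.+1, p))
    (v : {ffun 'I_p -> bool}) : R :=
  \sum_j pm R (v j) * (pm R (X (lift ord0 i) j) - pm R (X ord0 j)).

Lemma score_le (R : realType) k p (i : 'I_k) (X : 'M[bool]_(k.+1, p)) v :
  score R i X v <= 2 * p%:R.
Proof.
have -> : 2 * p%:R = \sum_(j < p) 2 :> R.
  by rewrite sumr_const card_ord -[RHS]mulr_natr.
apply: ler_sum => j _.
by case: (v j); case: (X _ _); case: (X _ _); rewrite /pm; lra.
Qed.

Definition hide_row k p (i : 'I_k) (Y : 'M[bool]_(k, p)) : 'M[bool]_(k, p) :=
  \matrix_(i', j) ((i' == i) || Y i' j).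

(* Once the mechanism no longer sees row i, its output is independent of which
   of rows 0 and i is which in each column, so the score is a Rademacher sum. *)
Lemma hidden_score_mgf (R : realType) k p (i : 'I_k)
    (mu : 'M[bool]_(k, p) -> {ffun 'I_p -> bool} -> R) (lam : R) :
  (forall Y v, 0 <= mu Y v) -> (forall Y, \sum_v mu Y v = 1) ->
  0 <= lam -> lam <= 4^-1 ->
  \sum_(X : 'M[bool]_(k.+1, p)) laplace_weight R X *
    (\sum_v mu (hide_row i (row' ord0 X)) v * expR (lam * score R i X v)) <=
  expR (8 * p%:R * lam ^+ 2) *
    \sum_(X : 'M[bool]_(k.+1, p)) laplace_weight R X.
Proof.
move=> mu0 mu1 lam0 lam4.
pose s (b : {ffun 'I_p -> bool}) (j : 'I_p) : 'S_k.+1 :=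
  if b j then 1%g else tperm ord0 (lift ord0 i).
pose H (X : 'M[bool]_(k.+1, p)) :=
  \sum_v mu (hide_row i (row' ord0 X)) v * expR (lam * score R i X v).
rewrite -[leLHS]/(\sum_X laplace_weight R X * H X).
have p2 : 0 < 2 ^+ p :> R by rewrite exprn_gt0.
rewrite -(ler_pM2l p2).
(* Averaging over the 2^p column-wise swaps of rows 0 and i is free, as each of them preserves the
   weight. *)
have -> : 2 ^+ p * (\sum_X laplace_weight R X * H X) =
    \sum_(X : 'M[bool]_(k.+1, p)) laplace_weight R X *
      \sum_(b : {ffun 'I_p -> bool}) H (perm_cols (s b) X).
  under [RHS]eq_bigr do rewrite mulr_sumr.
  rewrite exchange_big /=.
  under [RHS]eq_bigr do rewrite sum_laplace_weight_perm_cols.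
  by rewrite sumr_const card_ffun card_bool card_ord -[RHS]mulr_natl natrX.
rewrite !mulr_sumr; apply: ler_sum => X _.
rewrite mulrC mulrA ler_pM2r ?laplace_weight_gt0 //.
have hideE b : hide_row i (row' ord0 (perm_cols (s b) X)) =
    hide_row i (row' ord0 X).
  apply/matrixP => i' j; rewrite !mxE.
  have [//|i'i /=] := eqVneq i' i; rewrite /s; case: (b j).
    by rewrite perm1.
  by rewrite tpermD // ?neq_lift // eq_sym (inj_eq (@lift_inj _ _)).
(* A swap in column j flips the sign of that column's term, so b acts as a vector of random
   signs. *)
have scoreE b v : score R i (perm_cols (s b) X) v = \sum_j pm R (b j) *
    (pm R (v j) * (pm R (X (lift ord0 i) j) - pm R (X ord0 j))).
  apply: eq_bigr => j _; rewrite !mxE /s; case: (b j); rewrite ?perm1.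
    by rewrite /(pm R true) mul1r.
  by rewrite tpermL tpermR /(pm R false); ring.
under eq_bigr => b _.
  rewrite /H hideE; under eq_bigr do rewrite scoreE; over.
rewrite exchange_big /= -[leRHS]mul1r.
rewrite -[X in _ <= X * _](mu1 (hide_row i (row' ord0 X))).
rewrite mulr_suml; apply: ler_sum => v _; rewrite -mulr_sumr ler_wpM2l //.
under eq_bigr => b _.
  rewrite mulr_sumr; under eq_bigr do rewrite mulrCA; over.
have -> : 8 * p%:R * lam ^+ 2 = 2 * p%:R * (2 * lam) ^+ 2 by ring.
apply: rademacher_mgf; first lra.
move=> j; rewrite normrM ger0_norm // mulrC ler_wpM2r //.
rewrite normrM normr_pm mul1r (le_trans (ler_normB _ _)) //.
by rewrite !normr_pm.
Qed.

(** One row will stand for a group of equal data entries, so [eps] and [del] are parameters of group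
    privacy. *)
Definition row_private (R : realType) k p
    (mu : 'M[bool]_(k, p) -> {ffun 'I_p -> bool} -> R) (eps del : R) :=
  forall (i : 'I_k) (Y Y' : 'M[bool]_(k, p)),
  (forall i' j, i' != i -> Y i' j = Y' i' j) ->
  forall S : {set {ffun 'I_p -> bool}},
  \sum_(v in S) mu Y v <= expR eps * (\sum_(v in S) mu Y' v) + del.

(** Bound the score by T plus its excess over T. The excess lies between 0 and 2p, so privacy lets
    the mechanism forget row i at the price of a factor e^eps, which the term eps / lam of T
    absorbs; the term 8 p lam absorbs the moment generating function. Apart from the error in [del],
    the excess then costs only 1 / lam. *)
Lemma score_upper_bound (R : realType) k p (i : 'I_k)
    (mu nu : 'M[bool]_(k, p) -> {ffun 'I_p -> bool} -> R) (eps del lam : R) :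
  (forall Y v, 0 <= nu Y v <= mu Y v) -> (forall Y, \sum_v mu Y v = 1) ->
  row_private mu eps del -> 0 <= eps -> 0 < lam -> lam <= 4^-1 ->
  \sum_(X : 'M[bool]_(k.+1, p)) laplace_weight R X *
    (\sum_v nu (row' ord0 X) v * score R i X v) <=
  ((eps + 1) / lam + 8 * p%:R * lam + 2 * p%:R * del) *
    \sum_(X : 'M[bool]_(k.+1, p)) laplace_weight R X.
Proof.
move=> numu mu1 dp eps0 lam0 lam4; set M := \sum_X laplace_weight R X.
have mu0 Y v : 0 <= mu Y v by have /andP[/le_trans h /h] := numu Y v.
pose T := eps / lam + 8 * p%:R * lam.
have T0 : 0 <= T by rewrite addr_ge0 ?divr_ge0 ?mulr_ge0 // ltW.
pose c := lam^-1 * expR (- (8 * p%:R * lam ^+ 2)).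
have tail (X : 'M[bool]_(k.+1, p)) :
    \sum_v nu (row' ord0 X) v * score R i X v <= T + 2 * p%:R * del +
      c * \sum_v mu (hide_row i (row' ord0 X)) v * expR (lam * score R i X v).
  pose g v := Num.max 0 (score R i X v - T).
  have gB v : 0 <= g v <= 2 * p%:R.
    rewrite /g le_max lexx /= ge_max mulr_ge0 //=.
    by have := score_le R i X v; lra.
  have H : \sum_v mu (row' ord0 X) v * g v <= expR eps *
      (\sum_v mu (hide_row i (row' ord0 X)) v * g v) + del * (2 * p%:R).
    apply: dp_expectation => //.
    by apply: (dp i) => i' j i'i; rewrite !mxE (negbTE i'i).
  (* Privacy is known for [mu] and not for [nu]; replacing [nu] by [mu] is allowed because T + g is
     nonnegative. *)
  apply: (@le_trans _ _ (\sum_v mu (row' ord0 X) v * (T + g v))).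
    apply: ler_sum => v _; have /andP[n0 nm] := numu (row' ord0 X) v.
    apply: (@le_trans _ _ (nu (row' ord0 X) v * (T + g v))).
      by rewrite ler_wpM2l // /g; case: (lerP 0 (score R i X v - T)) => /=; lra.
    by rewrite ler_wpM2r // addr_ge0 //; case/andP: (gB v).
  under eq_bigr do rewrite mulrDr.
  rewrite big_split /= -mulr_suml mu1 mul1r -[leRHS]addrA lerD2l.
  apply: le_trans H _; rewrite [leLHS]addrC [del * _]mulrC lerD2l !mulr_sumr.
  apply: ler_sum => v _.
  rewrite mulrCA [leRHS]mulrCA ler_wpM2l //.
  have -> : c * expR (lam * score R i X v) =
      expR eps * (lam^-1 * expR (lam * (score R i X v - T))).
    rewrite /c -mulrA -expRD [RHS]mulrCA -expRD /T; congr (_ * expR _).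
    by field; rewrite gt_eqF.
  rewrite ler_pM2l ?expR_gt0 // -(ler_pM2l lam0) mulrA mulfV ?gt_eqF // mul1r.
  rewrite /g; case: (lerP 0 (score R i X v - T)) => h.
    by have := expR_ge1Dx (lam * (score R i X v - T)); lra.
  by rewrite mulr0 expR_ge0.
pose bound X := T + 2 * p%:R * del +
  c * \sum_v mu (hide_row i (row' ord0 X)) v * expR (lam * score R i X v).
apply: (@le_trans _ _ (\sum_X laplace_weight R X * bound X)).
  apply: ler_sum => X _; rewrite ler_wpM2l //.
  exact/ltW/laplace_weight_gt0.
rewrite /bound.
under eq_bigr do rewrite mulrDr mulrCA.
rewrite big_split /= -mulr_suml -mulr_sumr -/M.
have := hidden_score_mgf i mu0 mu1 (ltW lam0) lam4; rewrite -/M => mgf.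
have c0 : 0 <= c by rewrite mulr_ge0 ?invr_ge0 ?expR_ge0 // ltW.
rewrite -lerBrDl; apply: le_trans (ler_wpM2l c0 mgf) _.
rewrite /c mulrA -[lam^-1 * _ * _]mulrA -expRD addNr expR0 mulr1 /T.
by rewrite le_eqVlt; apply/orP; left; apply/eqP; field; rewrite gt_eqF.
Qed.

(** Nothing is divided by k: with a the vector of column means, [correlation] is k <v, a> and
    [col_energy] is k^2 |a|^2. *)
Definition correlation (R : realType) k p (Y : 'M[bool]_(k, p))
    (v : {ffun 'I_p -> bool}) : R := \sum_j pm R (v j) * col_sum R Y j.

Definition col_energy (R : realType) k p (Y : 'M[bool]_(k, p)) : R :=
  \sum_j col_sum R Y j ^+ 2.

(** The scores add up to the inner product of v with the column sums minus k y_0. By the rule of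
    succession y_0 averages to the column sums over k + 2, whatever [nu] does with the rows it sees,
    which leaves the fraction 2 / (k + 2). *)
Lemma sum_score_eq (R : realType) k p (nu : 'M[bool]_(k, p) ->
    {ffun 'I_p -> bool} -> R) :
  k.+2%:R * (\sum_(X : 'M[bool]_(k.+1, p)) laplace_weight R X *
    (\sum_v nu (row' ord0 X) v * \sum_i score R i X v)) =
  2 * (\sum_(X : 'M[bool]_(k.+1, p)) laplace_weight R X *
    (\sum_v nu (row' ord0 X) v * correlation R (row' ord0 X) v)).
Proof.
have scoreE (X : 'M[bool]_(k.+1, p)) v : \sum_i score R i X v =
    \sum_j pm R (v j) * (col_sum R (row' ord0 X) j - k%:R * pm R (X ord0 j)).
  rewrite exchange_big /=; apply: eq_bigr => j _; rewrite -mulr_sumr sumrB.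
  rewrite sumr_const card_ord -[_ *+ k]mulr_natl; congr (_ * (_ - _)).
  by apply: eq_bigr => i _; rewrite mxE.
apply/eqP; rewrite -subr_eq0 [X in X - _]mulr_sumr [X in _ - X]mulr_sumr.
rewrite -sumrB; apply/eqP.
transitivity (- k%:R * \sum_v \sum_j \sum_(X : 'M[bool]_(k.+1, p))
   laplace_weight R X * (nu (row' ord0 X) v * pm R (v j) *
    (k.+2%:R * pm R (X ord0 j) - col_sum R (row' ord0 X) j))); last first.
  rewrite big1 ?mulr0 // => v _; rewrite big1 // => j _.
  exact: (laplace_succession (fun Y => nu Y v * pm R (v j))).
under [in RHS]eq_bigr do rewrite exchange_big /=.
rewrite [in RHS]exchange_big mulr_sumr /=; apply: eq_bigr => X _.
rewrite mulrCA [2 * _]mulrCA -mulrBr.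
under [in RHS]eq_bigr do rewrite -mulr_sumr.
rewrite -mulr_sumr [RHS]mulrCA; congr (_ * _).
rewrite !mulr_sumr -sumrB; apply: eq_bigr => v _.
rewrite scoreE /correlation !mulr_sumr -sumrB; apply: eq_bigr => j _.
by rewrite -addn2 natrD; ring.
Qed.

Lemma sum_laplace_weight_col_energy (R : realType) k p :
  \sum_(X : 'M[bool]_(k.+1, p)) laplace_weight R X *
    col_energy R (row' ord0 X)
  = p%:R * (k%:R * k.+2%:R / 3) *
    \sum_(X : 'M[bool]_(k.+1, p)) laplace_weight R X.
Proof.
under eq_bigr do rewrite mulr_sumr.
rewrite exchange_big /=.
under eq_bigr do rewrite sum_laplace_weight_col_sum_sqr.
by rewrite sumr_const card_ord -[LHS]mulr_natl; ring.
Qed.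

(* [accurate Y v] says that the inner product of v with the column means of Y
   is at least their squared norm minus p / 18. *)
Definition accurate (R : realType) k p (Y : 'M[bool]_(k, p))
    (v : {ffun 'I_p -> bool}) : bool :=
  col_energy R Y - p%:R * k%:R ^+ 2 / 18 <= k%:R * correlation R Y v.

(** The total score on accurate outputs is estimated twice: from below through [sum_score_eq] and
    accuracy, from above row by row through [score_upper_bound], where lam = sqrt(eps / p) balances
    the main terms. *)
Lemma fingerprinting_bound (R : realType) k p
    (mu : 'M[bool]_(k, p) -> {ffun 'I_p -> bool} -> R) (eps del : R) :
  (0 < k)%N -> (forall Y v, 0 <= mu Y v) -> (forall Y, \sum_v mu Y v = 1) ->
  row_private mu eps del ->
  (forall Y, 2 / 3 <= \sum_(v | accurate R Y v) mu Y v) ->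
  1 <= eps -> 16 * eps <= p%:R ->
  p%:R / 3 <= k%:R * (10 * Num.sqrt (eps * p%:R) + 2 * p%:R * del).
Proof.
move=> k0 mu0 mu1 dp acc eps1 epsp.
pose nu Y v := if accurate R Y v then mu Y v else 0.
have numu Y v : 0 <= nu Y v <= mu Y v.
  by rewrite /nu; case: ifP; rewrite ?lexx mu0.
set M := \sum_(X : 'M[bool]_(k.+1, p)) laplace_weight R X.
have W0 (X : 'M[bool]_(k.+1, p)) : 0 <= laplace_weight R X.
  exact/ltW/laplace_weight_gt0.
have M0 : 0 < M.
  rewrite /M (bigD1 (\matrix_(i, j) true)) //= ltr_pwDl ?laplace_weight_gt0 //.
  exact: sumr_ge0.
have kR : 0 < k%:R :> R by rewrite ltr0n.
have p0 : 0 < p%:R :> R by lra.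
(* The accurate mass q lies in [2/3, 1]: the energy keeps a factor 2/3, the slack a factor at most
   1. *)
have corr (Y : 'M[bool]_(k, p)) :
    2 / 3 * col_energy R Y - p%:R * k%:R ^+ 2 / 18 <=
    k%:R * \sum_v nu Y v * correlation R Y v.
  have E0 : 0 <= col_energy R Y by apply: sumr_ge0 => j _; exact: sqr_ge0.
  have pk0 : 0 <= p%:R * k%:R ^+ 2 / 18 :> R.
    by rewrite divr_ge0 // mulr_ge0 // sqr_ge0.
  have q1 : \sum_v nu Y v <= 1.
    by rewrite -(mu1 Y); apply: ler_sum => v _; case/andP: (numu Y v).
  have q2 : 2 / 3 <= \sum_v nu Y v.
    by rewrite -big_mkcond; exact: acc.
  apply: (@le_trans _ _
    ((\sum_v nu Y v) * (col_energy R Y - p%:R * k%:R ^+ 2 / 18))).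
    by move: (\sum_v _) q1 q2 => q q1 q2; nra.
  rewrite mulr_suml mulr_sumr; apply: ler_sum => v _.
  rewrite [leRHS]mulrCA /nu; case: ifP => [h|_]; last by rewrite !mul0r.
  by rewrite ler_wpM2l.
have low : p%:R / 3 * M <= \sum_(X : 'M[bool]_(k.+1, p)) laplace_weight R X *
    (\sum_v nu (row' ord0 X) v * \sum_i score R i X v).
  have k2 : 0 < k.+2%:R :> R by [].
  rewrite -(ler_pM2l k2) sum_score_eq.
  have h : 2 / k%:R * (\sum_(X : 'M[bool]_(k.+1, p)) laplace_weight R X *
     (2 / 3 * col_energy R (row' ord0 X) - p%:R * k%:R ^+ 2 / 18)) <=
     2 * (\sum_(X : 'M[bool]_(k.+1, p)) laplace_weight R X *
    (\sum_v nu (row' ord0 X) v * correlation R (row' ord0 X) v)).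
    rewrite -mulrA ler_pM2l // mulr_sumr; apply: ler_sum => X _.
    by rewrite mulrCA ler_wpM2l // ler_pdivrMl.
  apply: le_trans h.
  under [X in _ <= _ * X]eq_bigr do rewrite mulrBr mulrCA.
  rewrite sumrB -mulr_sumr sum_laplace_weight_col_energy -mulr_suml -/M.
  have -> : k.+2%:R = k%:R + 2 :> R by rewrite -addn2 natrD.
  rewrite -subr_ge0.
  (* Up to the factor M, the main term 4/9 (k + 2) p exceeds the target by (k + 2) p / 9, and the
     slack of [accurate] takes k p / 9 of it. *)
  have -> : 2 / k%:R * (2 / 3 * (p%:R * (k%:R * (k%:R + 2) / 3) * M) -
      M * (p%:R * k%:R ^+ 2 / 18)) - (k%:R + 2) * (p%:R / 3 * M) =
      p%:R * M * (2 / 9) :> R by field; rewrite gt_eqF.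
  by rewrite !mulr_ge0 // ltW.
set s := Num.sqrt (eps * p%:R).
have ep0 : 0 < eps * p%:R by rewrite mulr_gt0 //; lra.
have s0 : 0 < s by rewrite sqrtr_gt0.
have s2 : s ^+ 2 = eps * p%:R by rewrite sqr_sqrtr // ltW.
have lam4 : s / p%:R <= 4^-1.
  rewrite ler_pdivrMr // -ler_sqr ?nnegrE ?mulr_ge0 ?(ltW s0) ?(ltW p0) // s2.
  by have := ler_wpM2r (ltW p0) epsp; lra.
have up (i : 'I_k) : \sum_(X : 'M[bool]_(k.+1, p)) laplace_weight R X *
    (\sum_v nu (row' ord0 X) v * score R i X v) <=
    (10 * s + 2 * p%:R * del) * M.
  apply: le_trans (score_upper_bound i numu mu1 dp (le_trans ler01 eps1)
    (divr_gt0 s0 p0) lam4) _.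
  rewrite ler_pM2r // lerD2r.
  have -> : (eps + 1) / (s / p%:R) = (eps * p%:R) / s + p%:R / s.
    by field; rewrite !gt_eqF.
  have -> : 8 * p%:R * (s / p%:R) = 8 * s by field; rewrite gt_eqF.
  rewrite -s2 expr2 mulfK ?gt_eqF //.
  suff : p%:R / s <= s by lra.
  by rewrite ler_pdivrMr // -expr2 s2 ler_peMl // ltW.
rewrite -(ler_pM2r M0); apply: le_trans low _.
under eq_bigr do under eq_bigr do rewrite mulr_sumr.
under eq_bigr do rewrite exchange_big mulr_sumr /=.
have -> : k%:R * (10 * s + 2 * p%:R * del) * M =
    \sum_(i < k) (10 * s + 2 * p%:R * del) * M.
  by rewrite sumr_const card_ord -[RHS]mulr_natl mulrA.
by rewrite exchange_big /=; apply: ler_sum => i _; exact: up.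
Qed.

(** * Mechanisms on multisets of cube vertices *)

Definition prob (d : measure_display) (T : measurableType d)
    (R : realType) (P : probability T R)
    (A : set T) : R := fine (P A).

Lemma probE (d : measure_display) (T : measurableType d)
    (R : realType) (P : probability T R) (A : set T) :
  measurable A -> P A = (prob P A)%:E.
Proof. by move=> mA; rewrite fineK // fin_num_measure. Qed.

Lemma prob_ge0 (d : measure_display) (T : measurableType d)
    (R : realType) (P : probability T R) (A : set T) : 0 <= prob P A.
Proof. exact: fine_ge0. Qed.

Lemma prob_setT (d : measure_display) (T : measurableType d)
    (R : realType) (P : probability T R) : prob P setT = 1.
Proof. by rewrite /prob probability_setT. Qed.

Lemma prob_le (d : measure_display) (T : measurableType d)
    (R : realType) (P : probability T R) (A B : set T) :
  measurable A -> measurable B -> (A `<=` B)%classic ->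
  prob P A <= prob P B.
Proof.
move=> mA mB AB; rewrite fine_le ?fin_num_measure //.
by apply: le_measure; rewrite ?inE.
Qed.

Lemma prob_setU (d : measure_display) (T : measurableType d)
    (R : realType) (P : probability T R) (A B : set T) :
  measurable A -> measurable B -> (A `&` B = set0)%classic ->
  prob P (A `|` B)%classic = prob P A + prob P B.
Proof.
move=> mA mB AB; apply: EFin_inj; rewrite EFinD -!probE //.
  exact: measureU.
exact: measurableU.
Qed.

Lemma prob_setC (d : measure_display) (T : measurableType d)
    (R : realType) (P : probability T R) (A : set T) :
  measurable A -> prob P (~` A) = 1 - prob P A.
Proof.
move=> mA; apply: EFin_inj; rewrite EFinB -!probE ?probability_setC //.
exact: measurableC.
Qed.

Lemma measurable_preimage_fin (d : measure_display) (T : measurableType d)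
    (V : finType) (f : T -> V) (Q : pred V) :
  (forall v, measurable (f @^-1` [set v])) ->
  measurable [set x | Q (f x)].
Proof.
move=> mf; have -> : [set x | Q (f x)] =
    \bigcup_(v in [set v | Q v]) (f @^-1` [set v]).
  by apply/seteqP; split=> [x Qx|x [v /= Qv ->]] //=; exists (f x).
by apply: fin_bigcup_measurable => // v _; exact: mf.
Qed.

Lemma prob_preimage_fin (d : measure_display) (T : measurableType d)
    (R : realType) (P : probability T R)
    (V : finType) (f : T -> V) (Q : pred V) :
  (forall v, measurable (f @^-1` [set v])) ->
  prob P [set x | Q (f x)] = \sum_(v | Q v) prob P (f @^-1` [set v]).
Proof.
move=> mf; apply: EFin_inj; rewrite -sumEFin -probE; last first.
  exact: measurable_preimage_fin.
have -> : [set x | Q (f x)] = \bigcup_(v in [set v | Q v]) (f @^-1` [set v]).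
  by apply/seteqP; split=> [x Qx|x [v /= Qv ->]] //=; exists (f x).
have tf : trivIset [set v | Q v] (fun v => f @^-1` [set v]).
  by move=> v w _ _ [x [/= <- <-]].
rewrite (measure_fin_bigcup _ finite_finset tf (fun v _ => mf v)).
rewrite [RHS](eq_bigr (fun v => P (f @^-1` [set v]))) => [|v _]; last first.
  by rewrite -probE //; exact: mf.
rewrite -[RHS]big_filter [RHS]fsbig_seq ?filter_uniq ?index_enum_uniq //.
suff -> : [set v | Q v] = [set` [seq v <- index_enum V | Q v]] by [].
by apply/seteqP; split=> v /=; rewrite mem_filter mem_index_enum andbT.
Qed.

Lemma closed_measurable_rV (R : realType) p (F : set 'rV[R]_p) :
  closed F -> measurable (F : set (borel_rV R p)).
Proof.
move=> cF; rewrite -[F]setCK; apply: measurableC.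
by apply: sub_sigma_algebra; exact: closed_openC.
Qed.

Lemma measurable_coord_ge (R : realType) p (j : 'I_p) (b : R) :
  measurable ([set theta : 'rV[R]_p | b <= theta ord0 j]
    : set (borel_rV R p)).
Proof.
apply: closed_measurable_rV.
apply: (@preimage_closed _ _ (fun theta : 'rV[R]_p => theta ord0 j)
  [set x | b <= x]); last exact: closed_ge.
by move=> x _; exact: coord_continuous.
Qed.

Lemma measurable_sqr_dist_ge (R : realType) p (m : 'rV[R]_p) (b : R) :
  measurable ([set theta : 'rV[R]_p |
     b <= \sum_j (theta ord0 j - m ord0 j) ^+ 2] : set (borel_rV R p)).
Proof.
apply: closed_measurable_rV.
apply: (@preimage_closed _ _ (fun theta : 'rV[R]_p =>
   \sum_j (theta ord0 j - m ord0 j) ^+ 2)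
  [set x | b <= x]); last exact: closed_ge.
move=> x _; move: x; apply: continuous_big => [|j _ x].
  exact: add_continuous.
have h : {for x, continuous (fun theta : 'rV[R]_p =>
    theta ord0 j - m ord0 j)}.
  by apply: continuousB; [exact: coord_continuous|exact: cst_continuous].
exact: (continuousM h h).
Qed.

Definition cube_row (R : realType) p (b : 'I_p -> bool) : 'rV[R]_p :=
  \row_j (pm R (b j) / Num.sqrt p%:R).

Lemma hypercube_cube_row (R : realType) p (b : 'I_p -> bool) :
  hypercube (cube_row R b).
Proof.
move=> j; rewrite mxE; case: (b j); rewrite /pm ?mul1r ?mulN1r; [by right|].
by left.
Qed.

Definition data_seq (R : realType) n p (s : seq 'rV[R]_p) : Prop :=
  size s = n /\ forall d, d \in s -> hypercube d.

Lemma data_seq_perm (R : realType) n p (s s' : seq 'rV[R]_p) :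
  perm_eq s s' -> data_seq n s -> data_seq n s'.
Proof.
move=> ss' [sn sh]; split=> [|d]; first by rewrite -(perm_size ss').
by rewrite -(perm_mem ss'); exact: sh.
Qed.

Lemma dataset_seq_mset (R : realType) n p (s : seq 'rV[R]_p) :
  data_seq n s -> dataset n (seq_mset s).
Proof. by apply: data_seq_perm; rewrite perm_sym perm_eq_seq_mset. Qed.

Lemma mean_seq_mset (R : realType) p (s : seq 'rV[R]_p) j :
  mean (seq_mset s) ord0 j = (size s)%:R^-1 * \sum_(d <- s) d ord0 j.
Proof.
by rewrite mxE summxE (perm_size (perm_eq_seq_mset s))
  (perm_big _ (perm_eq_seq_mset s)).
Qed.

Lemma excess_lossE (R : realType) p (D : {mset 'rV[R]_p}) theta :
  loss D theta - loss D (mean D) = 2^-1 * (size D)%:R *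
    \sum_j (theta ord0 j - mean D ord0 j) ^+ 2.
Proof.
rewrite loss_mean addrAC subrr add0r norm2_sqr; congr (_ * _).
by apply: eq_bigr => j _; rewrite !mxE.
Qed.

(** A consequence of the negated goal, with the excess loss written as a scaled squared distance to
    the mean. Quantifying over measurable supersets [E] lets any event implied by closeness be used
    directly. *)
Definition close_whp (R : realType) n p (t : R) (A : algorithm R p) : Prop :=
  forall s, data_seq n s -> forall E : set (borel_rV R p), measurable E ->
  (forall theta : 'rV[R]_p, 2^-1 * n%:R *
     (\sum_j (theta ord0 j - mean (seq_mset s) ord0 j) ^+ 2) < t -> E theta) ->
  2 / 3 < prob (A (seq_mset s)) E.

Lemma close_whp_of_no_bad_dataset (R : realType) n p (t : R)
    (A : algorithm R p) :
  (0 < n)%N ->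
  ~ (exists D : {mset 'rV[R]_p}, dataset n D /\
    ((1 / 3)%:E <= A D [set theta : 'rV[R]_p |
        (t <= loss D theta - loss D (mean D))%R])%E) ->
  close_whp n t A.
Proof.
move=> n0 nobad s sd E mE hE.
have dD := dataset_seq_mset sd; set D := seq_mset s in dD hE *.
pose B := [set theta : 'rV[R]_p | t <= loss D theta - loss D (mean D)].
have sD : size D = n by case: dD.
have nR : 0 < 2^-1 * n%:R :> R by rewrite mulr_gt0 ?ltr0n.
have BE : B = [set theta : 'rV[R]_p | t / (2^-1 * n%:R) <=
    \sum_j (theta ord0 j - mean D ord0 j) ^+ 2].
  apply/seteqP; split=> theta; rewrite /B /= excess_lossE sD;
    by rewrite ler_pdivrMr // mulrC.
have mB : measurable (B : set (borel_rV R p)).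
  by rewrite BE; exact: measurable_sqr_dist_ge.
have Blt : prob (A D) B < 1 / 3.
  rewrite ltNge; apply/negP => h; apply: nobad; exists D; split => //.
  by rewrite -/B probE // lee_fin.
have := prob_setC (A D) mB => BC.
apply: lt_le_trans (prob_le _ (measurableC mB) mE _); first lra.
move=> theta /= /negP; rewrite -ltNge excess_lossE sD => h.
exact: hE.
Qed.

(** [neighbors] asks for distinct entries, so x = y is treated apart; the absolute value of [delta]
    makes the bound valid there too. *)
Lemma private_step (R : realType) n p (eps delta : R) (A : algorithm R p)
    x y r (E : set (borel_rV R p)) :
  differentially_private n eps delta A -> 0 <= eps ->
  data_seq n (x :: r) -> hypercube y -> measurable E ->
  prob (A (seq_mset (x :: r))) E <=
    expR eps * prob (A (seq_mset (y :: r))) E + `|delta|.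
Proof.
move=> dp eps0 xr hy mE.
have [->|xy] := eqVneq x y.
  rewrite -[leLHS]addr0 lerD // ler_peMl ?prob_ge0 //.
  by rewrite -[leLHS]expR0 ler_expR.
have yr : data_seq n (y :: r).
  case: xr => sn sh; split=> // d; rewrite inE => /orP[/eqP -> //|dr].
  by apply: sh; rewrite inE dr orbT.
have : (A (seq_mset (x :: r)) E <=
    (expR eps)%:E * A (seq_mset (y :: r)) E + delta%:E)%E.
  apply: dp => //; [exact: dataset_seq_mset|exact: dataset_seq_mset|].
  by exists (seq_mset r), x, y; rewrite !mset_cons.
rewrite !probE // -EFinM -EFinD lee_fin => /le_trans; apply.
by rewrite lerD2l ler_norm.
Qed.

(** Copies are replaced one by one, and the errors form a geometric sum with largest term e^(eps (m
    - 1)) |delta|. The exponent m - 1 matters: for m = 1 the additive term stays bounded even when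
    eps is large. *)
Lemma group_private (R : realType) n p (eps delta : R) (A : algorithm R p)
    m x y r (E : set (borel_rV R p)) :
  differentially_private n eps delta A -> 0 <= eps ->
  data_seq n (nseq m x ++ r) -> hypercube x -> hypercube y -> measurable E ->
  prob (A (seq_mset (nseq m x ++ r))) E <=
    expR (eps *+ m) * prob (A (seq_mset (nseq m y ++ r))) E +
    expR (eps *+ m.-1) * m%:R * `|delta|.
Proof.
move=> dp eps0 + hx hy mE; elim: m r => [|m IH] r xr.
  by rewrite mulr0n expR0 mul1r mulr0 mul0r addr0.
have pe (z : 'rV[R]_p) w k :
    perm_eq (z :: (nseq k w ++ r)) (nseq k w ++ z :: r).
  by rewrite perm_sym -cat1s perm_catCA.
have xr' : data_seq n (nseq m x ++ y :: r).
  apply: data_seq_perm (pe y x m) _.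
  case: xr => sn sh; split=> // d; rewrite inE => /orP[/eqP -> //|dr].
  by apply: sh; rewrite inE dr orbT.
apply: le_trans (private_step dp eps0 xr hy mE) _.
have -> : seq_mset (y :: (nseq m x ++ r)) = seq_mset (nseq m x ++ y :: r).
  exact/eq_seq_msetP/pe.
have -> : seq_mset (nseq m.+1 y ++ r) = seq_mset (nseq m y ++ y :: r).
  exact/eq_seq_msetP/pe.
have h := ler_wpM2l (expR_ge0 eps) (IH _ xr').
apply: le_trans (lerD h (lexx _)) _.
rewrite mulrDr mulrA -expRD -mulrS -addrA lerD2l /=.
rewrite mulrA -[X in _ + X <= _]mul1r -mulrDl ler_wpM2r //.
case: m {IH xr pe xr' h} => [|m] /=.
  by rewrite mulr0n expR0 mulr0 mulr0 add0r mul1r.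
rewrite mulrA -expRD -mulrS -[m.+2]addn1 natrD mulrDr mulr1 lerD2l.
by rewrite -[leLHS]expR0 ler_expR mulrn_wge0.
Qed.

(** exp(1/4) <= 4/3, and (4/3)^4 = 256/81 < 16/5. *)
Lemma expR1_le (R : realType) : expR 1 <= 16 / 5 :> R.
Proof.
have -> : expR 1 = (expR 4^-1) ^+ 2 ^+ 2 :> R.
  by rewrite !expr2 -!expRD; congr expR; field.
have e0 := expR_gt0 (4^-1 : R).
have := expR_ge1Dx (- 4^-1 : R); rewrite expRN => h.
have h2 : expR 4^-1 <= 4 / 3 :> R.
  have : (1 - 4^-1) * expR 4^-1 <= 1 :> R.
    by rewrite -[leRHS](mulVf (lt0r_neq0 e0)) ler_wpM2r // ltW.
  by lra.
have h4 := ler_pM (ltW e0) (ltW e0) h2 h2.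
have := ler_pM (mulr_ge0 (ltW e0) (ltW e0)) (mulr_ge0 (ltW e0) (ltW e0)) h4 h4.
by lra.
Qed.

(** * Low dimension *)

Lemma sum_nseq_coord (R : realType) p m (x : 'rV[R]_p) j :
  \sum_(d <- nseq m x) d ord0 j = m%:R * x ord0 j.
Proof. by rewrite big_nseq iter_addr_0 mulr_natl. Qed.

Lemma prob_coord_itv (R : realType) p (P : probability (borel_rV R p) R) j
    (b c : R) : b <= c ->
  let H z : set (borel_rV R p) := [set theta : 'rV[R]_p | z <= theta ord0 j] in
  prob P (H b `&` ~` H c)%classic = prob P (H b) - prob P (H c).
Proof.
move=> bc H.
have mH z : measurable (H z) by exact: measurable_coord_ge.
apply/eqP; rewrite eq_sym subr_eq -prob_setU //; last 2 first.
- by apply: measurableI => //; exact: measurableC.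
- by rewrite -setIA setICl setI0.
apply/eqP; congr prob; apply/seteqP; split=> theta /=; rewrite /H /=.
  by move=> h; case: (boolP (c <= theta ord0 j)) => /negP h'; [right|left].
by move=> [[]//|]; exact: le_trans.
Qed.

(* Three data sets whose means are pairwise separated along one coordinate: on
   the middle one the mechanism would have to put mass 2/3 on its own cell and
   about 2/(3e) on each of the two others, more than 1 in total. *)
Lemma three_point_bound (R : realType) n p m (t eps delta : R)
    (A : algorithm R p) :
  (0 < p)%N -> (0 < m)%N -> (2 * m <= n)%N -> 0 <= eps -> eps *+ m <= 1 ->
  m%:R * `|delta| <= 1 / 100 ->
  t <= 2^-1 * n%:R * (m%:R / (n%:R * Num.sqrt p%:R)) ^+ 2 ->
  differentially_private n eps delta A -> ~ close_whp n t A.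
Proof.
move=> p0 m0 mn eps0 epsm dm tle dp cw.
have n0 : (0 < n)%N by lia.
case: p p0 A dp cw tle => [//|p] _ A dp cw tle.
set w := Num.sqrt p.+1%:R in tle.
have w0 : 0 < w by rewrite sqrtr_gt0.
have nR : 0 < n%:R :> R by rewrite ltr0n.
have mR : 0 < m%:R :> R by rewrite ltr0n.
set h := m%:R / (n%:R * w) in tle.
have h0 : 0 < h by rewrite divr_gt0 // mulr_gt0.
pose x := cube_row R (fun _ : 'I_p.+1 => false).
pose y := cube_row R (fun _ : 'I_p.+1 => true).
(* Only [s 0], [s m] and [s (2 * m)] matter: consecutive means are 2h apart in the first coordinate,
   so their cells of radius h are adjacent and disjoint. *)
pose s a := nseq a x ++ nseq (n - a) y.
have hx : hypercube x := hypercube_cube_row R _.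
have hy : hypercube y := hypercube_cube_row R _.
have sd a : (a <= n)%N -> data_seq n (s a).
  move=> an; split=> [|d]; first by rewrite size_cat !size_nseq subnKC.
  by rewrite mem_cat !mem_nseq => /orP[/andP[_ /eqP ->]|/andP[_ /eqP ->]].
have sm a : (a <= n)%N ->
    mean (seq_mset (s a)) ord0 ord0 = w^-1 - 2 * a%:R / (n%:R * w).
  move=> an; have [sz _] := sd _ an; rewrite mean_seq_mset sz big_cat /=.
  rewrite !sum_nseq_coord /x /y !mxE /pm natrB // -/w.
  by field; rewrite !gt_eqF.
pose H z : set (borel_rV R p.+1) :=
  [set theta : 'rV[R]_p.+1 | z <= theta ord0 ord0].
have mH z : measurable (H z) by exact: measurable_coord_ge.
pose cell b := (H (b - h) `&` ~` H (b + h))%classic.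
have mcell b : measurable (cell b).
  by apply: measurableI => //; exact: measurableC.
have cellE (P : probability (borel_rV R p.+1) R) b :
    prob P (cell b) = prob P (H (b - h)) - prob P (H (b + h)).
  by apply: (@prob_coord_itv R p.+1 P ord0); lra.
have hit a : (a <= n)%N ->
    2 / 3 < prob (A (seq_mset (s a))) (cell (w^-1 - 2 * a%:R / (n%:R * w))).
  move=> an; apply: (cw _ (sd _ an)) => // theta; rewrite -(sm _ an).
  set mu := mean _ => /lt_le_trans/(_ tle).
  rewrite ltr_pM2l ?mulr_gt0 // big_ord_recl => lt.
  have {}lt : (theta ord0 ord0 - mu ord0 ord0) ^+ 2 < h ^+ 2.
    apply: le_lt_trans lt; rewrite lerDl sumr_ge0 // => j _; exact: sqr_ge0.
  move: lt; rewrite -[X in X < _]real_normK ?num_real //.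
  rewrite ltr_sqr ?nnegrE ?normr_ge0 ?(ltW h0) // ltr_norml => /andP[l1 l2].
  split; rewrite /H /=; first lra.
  by apply/negP; rewrite -ltNge; lra.
pose P := A (seq_mset (s m)).
have near_ a E : (a = 0 \/ a = 2 * m)%N -> measurable E ->
    prob (A (seq_mset (s a))) E <= 16 / 5 * prob P E + 1 / 25.
  move=> a02 mE; have an : (a <= n)%N by lia.
  (* Changing m equal entries leads to the middle data set: y to x from [s 0], x to y from
     [s (2 * m)]. *)
  have [u [v [r [hu hv Pu Pv]]]] : exists u v r, [/\ hypercube u, hypercube v,
      seq_mset (s a) = seq_mset (nseq m u ++ r) &
      seq_mset (s m) = seq_mset (nseq m v ++ r)].
    case: a02 => ->.
      exists y, x, (nseq (n - m) y); split => //; congr seq_mset.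
      by rewrite /s subn0 -nseqD subnKC //; lia.
    exists x, y, (nseq m x ++ nseq (n - 2 * m) y); split => //.
      by rewrite /s catA -nseqD addnn -mul2n.
    apply/eq_seq_msetP; rewrite perm_sym perm_catCA /s perm_cat2l -nseqD.
    by have -> : (m + (n - 2 * m) = n - m)%N by lia.
  have dr : data_seq n (nseq m u ++ r).
    by apply: data_seq_perm (sd _ an); apply/eq_seq_msetP.
  have := group_private dp eps0 dr hu hv mE; rewrite -Pu -Pv -/P.
  have q0 := prob_ge0 P E.
  have e1 : expR (eps *+ m) <= 16 / 5.
    by apply: le_trans (expR1_le R); rewrite ler_expR.
  have e2 : expR (eps *+ m.-1) <= 16 / 5.
    apply: le_trans (expR1_le R); rewrite ler_expR; apply: le_trans epsm.
    rewrite -[leLHS]mulr_natr -[leRHS]mulr_natr ler_wpM2l //.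
    by rewrite ler_nat leq_pred.
  have h1 := ler_wpM2r q0 e1.
  have h2 : expR (eps *+ m.-1) * (m%:R * `|delta|) <= 16 / 5 * (1 / 100).
    by rewrite ler_pM ?expR_ge0 ?mulr_ge0 ?normr_ge0.
  by rewrite -mulrA; lra.
have := near_ 0%N _ (or_introl erefl) (mcell (w^-1 - 2 * 0%:R / (n%:R * w))).
have := near_ (2 * m)%N _ (or_intror erefl)
  (mcell (w^-1 - 2 * (2 * m)%:R / (n%:R * w))).
have := hit 0%N ltac:(lia); have := hit m ltac:(lia).
have := hit (2 * m)%N ltac:(lia).
rewrite -/P !cellE.
have -> : 2 * m%:R / (n%:R * w) = 2 * h by rewrite /h; field; rewrite !gt_eqF.
have -> : 2 * (2 * m)%:R / (n%:R * w) = 4 * h.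
  by rewrite /h natrM; field; rewrite !gt_eqF.
rewrite mulr0 mul0r subr0.
have -> : w^-1 - 2 * h + h = w^-1 - h by ring.
have -> : w^-1 - 4 * h + h = w^-1 - 2 * h - h by ring.
have := prob_ge0 P (H (w^-1 + h)).
have := prob_le P (mH (w^-1 - 4 * h - h)) measurableT (@subsetT _ _).
(* The three cells telescope. Each outer one has mass above (5/16)(2/3 - 1/25) > 0.19, and 2/3 + 2 *
   0.19 > 1. *)
rewrite prob_setT; lra.
Qed.

(** * Reduction to a finite mechanism *)

(** If the signs agree, k |s| >= s^2. If they differ, |q - s| >= |s|, and k |s| <= k^2 / 36 + 9 s^2
    leaves 10 s^2 <= 36 (q - s)^2. *)
Lemma sign_agreement (R : realType) (k q s : R) : `|s| <= k ->
  s ^+ 2 - k ^+ 2 / 36 - 36 * (q - s) ^+ 2 <= k * (pm R (0 <= q) * s).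
Proof.
rewrite ler_norml => /andP[s1 s2].
have h1 : 0 <= (k / 6 - 3 * s) ^+ 2 by exact: sqr_ge0.
have h2 : 0 <= (k / 6 + 3 * s) ^+ 2 by exact: sqr_ge0.
have h3 : 0 <= (q - s) ^+ 2 by exact: sqr_ge0.
have h4 : 0 <= k ^+ 2 by exact: sqr_ge0.
rewrite /pm; case: (lerP 0 q) => q0; have [s0|s0] := lerP 0 s.
- have : 0 <= (k - s) * s by rewrite mulr_ge0 //; lra.
  by lra.
- have : 0 <= q * (- s) by rewrite mulr_ge0 //; lra.
  have := sqr_ge0 q; have := sqr_ge0 s; lra.
- have : 0 <= (- q) * s by rewrite mulr_ge0 //; lra.
  have := sqr_ge0 q; have := sqr_ge0 s; lra.
- have : 0 <= (k + s) * (- s) by rewrite mulr_ge0 //; lra.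
  by lra.
Qed.

(** The threshold [b] will be the share of the padding rows in each coordinate of the mean. *)
Definition sign_vector (R : realType) p (b : R) (theta : borel_rV R p) :
    {ffun 'I_p -> bool} := [ffun j => b <= (theta : 'rV[R]_p) ord0 j].

Lemma measurable_sign_vector (R : realType) p (b : R) v :
  measurable (@sign_vector R p b @^-1` [set v]).
Proof.
pose H (j : 'I_p) : set (borel_rV R p) :=
  [set theta : 'rV[R]_p | b <= theta ord0 j].
have mH j : measurable (H j) by exact: measurable_coord_ge.
have -> : @sign_vector R p b @^-1` [set v] =
    \bigcap_(j in [set: 'I_p]) (if v j then H j else ~` H j).
  apply/seteqP; split=> theta /=.
    move=> <- j _; rewrite ffunE /H; case: ifPn => //= /negP.
    by [].
  move=> h; apply/ffunP => j; rewrite ffunE; have := h j I.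
  by rewrite /H; case: (v j) => [//|/= /negP/negbTE].
apply: fin_bigcap_measurable => [|j _]; first exact: finite_finset.
by case: (v j) => //; exact: measurableC.
Qed.

Definition replicated_data (R : realType) n k p m (Y : 'M[bool]_(k, p)) :
    seq 'rV[R]_p :=
  flatten [seq nseq m (cube_row R (Y i)) | i <- enum 'I_k] ++
  nseq (n - k * m) (cube_row R (fun=> true)).

Lemma data_seq_replicated (R : realType) n k p m (Y : 'M[bool]_(k, p)) :
  (k * m <= n)%N -> data_seq n (replicated_data R n m Y).
Proof.
move=> kmn; split=> [|d].
  rewrite size_cat size_nseq size_flatten sumnE /shape 2!big_map.
  rewrite (eq_bigr (fun=> m)) => [|i _]; last by rewrite size_nseq.
  by rewrite big_enum sum_nat_const card_ord subnKC.
rewrite mem_cat => /orP[/flattenP[s /mapP[i _ ->]]|];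
  by rewrite mem_nseq => /andP[_ /eqP ->]; exact: hypercube_cube_row.
Qed.

Lemma mean_replicated (R : realType) n k p m (Y : 'M[bool]_(k, p)) j :
  (k * m <= n)%N -> mean (seq_mset (replicated_data R n m Y)) ord0 j =
  n%:R^-1 * ((m%:R * col_sum R Y j + (n - k * m)%:R) / Num.sqrt p%:R).
Proof.
move=> kmn; have [sz _] := data_seq_replicated R Y kmn.
rewrite mean_seq_mset sz; congr (_ * _).
rewrite big_cat /= big_flatten big_map sum_nseq_coord mxE /pm mul1r.
rewrite big_enum /= mulrDl /col_sum mulr_sumr mulr_suml; congr (_ + _).
by apply: eq_bigr => i _; rewrite sum_nseq_coord mxE mulrA.
Qed.

(** Moves the block of row i to the front, the form that [group_private] needs. *)
Lemma replicated_data_row (R : realType) n k p m (i : 'I_k)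
    (Y Y' : 'M[bool]_(k, p)) :
  (forall i' j, i' != i -> Y i' j = Y' i' j) ->
  exists r, seq_mset (replicated_data R n m Y) =
      seq_mset (nseq m (cube_row R (Y i)) ++ r) /\
    seq_mset (replicated_data R n m Y') =
      seq_mset (nseq m (cube_row R (Y' i)) ++ r).
Proof.
move=> YY'; pose rest (Z : 'M[bool]_(k, p)) :=
  flatten [seq nseq m (cube_row R (Z i')) | i' <- rem i (enum 'I_k)].
pose pad := nseq (n - k * m) (cube_row R (fun _ : 'I_p => true)).
have split_row (Z : 'M[bool]_(k, p)) : seq_mset (replicated_data R n m Z) =
    seq_mset (nseq m (cube_row R (Z i)) ++ (rest Z ++ pad)).
  apply/eq_seq_msetP; rewrite catA perm_cat2r.
  have : i \in enum 'I_k by rewrite mem_enum.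
  move=> /perm_to_rem/(perm_map (fun i' => nseq m (cube_row R (Z i')))).
  exact: perm_flatten.
exists (rest Y ++ pad); rewrite !split_row; split=> //.
suff -> : rest Y' = rest Y by [].
congr flatten; apply/eq_in_map => i'; rewrite mem_rem_uniq ?enum_uniq //.
rewrite !inE => /andP[i'i _]; congr nseq.
by apply/rowP => j; rewrite !mxE YY'.
Qed.

(** Group privacy makes the sign vector [row_private]. An excess loss below t bounds the rescaled
    squared error by p k^2 / 36^2, so [sign_agreement] loses p k^2 / 36 twice, which is the slack p
    k^2 / 18 of [accurate]. *)
Lemma private_fingerprinting_bound (R : realType) n p k m
    (t eps eps' delta : R) (A : algorithm R p) :
  (0 < k)%N -> (0 < m)%N -> (k * m <= n)%N -> 0 <= eps ->
  eps *+ m <= eps' -> eps *+ m.-1 <= 1 -> 1 <= eps' -> 16 * eps' <= p%:R ->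
  t <= 2^-1 * n%:R * (((k * m)%:R / n%:R) ^+ 2 / 36 ^+ 2) ->
  differentially_private n eps delta A -> close_whp n t A ->
  p%:R / 3 <= k%:R * (10 * Num.sqrt (eps' * p%:R) +
    2 * p%:R * (16 / 5 * (m%:R * `|delta|))).
Proof.
move=> k0 m0 kmn eps0 epsm epsm1 eps1 epsp tle dp cw.
have n0 : (0 < n)%N by apply: leq_trans kmn; rewrite muln_gt0 k0.
have nR : 0 < n%:R :> R by rewrite ltr0n.
have mR : 0 < m%:R :> R by rewrite ltr0n.
have kR : 0 < k%:R :> R by rewrite ltr0n.
have pR : 0 < p%:R :> R by lra.
pose w : R := Num.sqrt p%:R; have w0 : 0 < w by rewrite sqrtr_gt0.
have w2 : w ^+ 2 = p%:R by rewrite sqr_sqrtr // ltW.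
pose b : R := (n - k * m)%:R / (n%:R * w).
pose D (Y : 'M[bool]_(k, p)) := seq_mset (replicated_data R n m Y).
have mE Q := measurable_preimage_fin Q (@measurable_sign_vector R p b).
have probQ Y Q := prob_preimage_fin (A (D Y)) Q (@measurable_sign_vector R p b).
pose mu Y v := prob (A (D Y)) (@sign_vector R p b @^-1` [set v]).
apply: (@fingerprinting_bound R k p mu) => //.
- by move=> Y v; exact: prob_ge0.
- move=> Y; rewrite -(probQ Y xpredT) -(prob_setT (A (D Y))).
  by congr prob; apply/seteqP; split.
- move=> i Y Y' YY' S; rewrite -!(probQ _ (mem S)).
  have [r [Yr Y'r]] := replicated_data_row R n m YY'.
  have dr : data_seq n (nseq m (cube_row R (Y i)) ++ r).
    by apply: data_seq_perm (data_seq_replicated R Y kmn); apply/eq_seq_msetP.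
  have := group_private dp eps0 dr (hypercube_cube_row R _)
    (hypercube_cube_row R (Y' i)) (mE (mem S)).
  rewrite -Yr -Y'r -!/(D _) => /le_trans; apply; apply: lerD.
    by rewrite ler_wpM2r ?prob_ge0 // ler_expR.
  rewrite -mulrA ler_wpM2r ?mulr_ge0 //.
  by apply: le_trans (expR1_le R); rewrite ler_expR.
- move=> Y; rewrite -(probQ Y (accurate R Y)); apply/ltW/(cw _ _ _ (mE _)).
    exact: data_seq_replicated.
  move=> theta /lt_le_trans/(_ tle); rewrite ltr_pM2l ?mulr_gt0 // => close.
  (* The output with the padding removed, rescaled to estimate the column sums. *)
  set z := fun j => n%:R * w / m%:R * (theta ord0 j - b).
  have vE j : pm R (sign_vector b theta j) = pm R (0 <= z j).
    by rewrite ffunE /z pmulr_rge0 ?divr_gt0 ?mulr_gt0 // subr_ge0.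
  have zE j : z j - col_sum R Y j = n%:R * w / m%:R *
      (theta ord0 j - mean (D Y) ord0 j).
    rewrite mean_replicated // -/w /z /b; field; rewrite !gt_eqF //.
  have Sk j : `|col_sum R Y j| <= k%:R.
    apply: le_trans (ler_norm_sum _ _ _) _.
    under eq_bigr do rewrite normr_pm.
    by rewrite sumr_const card_ord.
  rewrite /accurate /= /correlation /col_energy.
  rewrite [in leRHS](eq_bigr (fun j => pm R (0 <= z j) * col_sum R Y j))
    => [|j _]; last by rewrite vE.
  have : \sum_j (col_sum R Y j ^+ 2 - k%:R ^+ 2 / 36 -
        36 * (z j - col_sum R Y j) ^+ 2) <=
      \sum_j k%:R * (pm R (0 <= z j) * col_sum R Y j).
    by apply: ler_sum => j _; exact: sign_agreement.
  rewrite -[leRHS]mulr_sumr; apply: le_trans.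
  rewrite !sumrB sumr_const card_ord -mulr_sumr.
  under [X in _ <= _ - _ * X]eq_bigr do rewrite zE exprMn.
  rewrite -mulr_sumr.
  set X := \sum_j _ in close *; set Z := \sum_j _.
  have : (n%:R * w / m%:R) ^+ 2 * X <=
     (n%:R * w / m%:R) ^+ 2 * (((k * m)%:R / n%:R) ^+ 2 / 36 ^+ 2).
    by rewrite ler_wpM2l ?sqr_ge0 // ltW.
  have -> : (n%:R * w / m%:R) ^+ 2 * (((k * m)%:R / n%:R) ^+ 2 / 36 ^+ 2) =
    p%:R * k%:R ^+ 2 / 36 ^+ 2.
    by rewrite natrM -w2; field; rewrite !gt_eqF.
  by rewrite -[_ *+ p]mulr_natl; lra.
Qed.

(** * Choice of parameters *)

(** Take the minimum of N and the integer part of x; as x >= 1, rounding down loses at most a factor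
    2. *)
Lemma nat_below (R : realType) (N : nat) (x : R) : (0 < N)%N -> 1 <= x ->
  exists m : nat, [/\ (0 < m <= N)%N, m%:R <= x &
    N%:R <= 2 * m%:R :> R \/ x <= 2 * m%:R].
Proof.
move=> N0 x1; have /truncn_itv/andP[lo hi] : 0 <= x by lra.
set q := Num.truncn x in lo hi.
have q0 : (0 < q)%N by case: q lo hi => [|//]; lra.
have q1 : 1 <= q%:R :> R by rewrite ler1n.
have NR : 1 <= N%:R :> R by rewrite ler1n.
exists (minn N q); split.
- by rewrite leq_min N0 q0 geq_minl.
- by apply: le_trans lo; rewrite ler_nat geq_minr.
- case: leqP => h; [left; lra|right].
  by apply: ltW; apply: lt_le_trans hi _; rewrite -natr1; lra.
Qed.

(** With m about min(n / 2, 1 / eps), [three_point_bound] allows t up to m^2 / (2 n p). The two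
    cases for m yield the two terms of the minimum, and the bounded dimension is absorbed in c. *)
Lemma not_close_low_dimension (R : realType) (c K : R) n p (eps delta : R)
    (A : algorithm R p) :
  0 < c -> c * (128 * K ^+ 2) <= 1 ->
  (1 < n)%N -> (0 < p)%N -> p%:R <= K :> R -> 0 < eps -> eps <= 1 ->
  n%:R * `|delta| <= 1 / 100 -> differentially_private n eps delta A ->
  ~ close_whp n (c * Num.min n%:R (p%:R / (eps ^+ 2 * n%:R))) A.
Proof.
move=> c0 + n1.
have [n4 half_le] : (n <= 4 * n./2)%N /\
    forall m, (m <= n./2 -> 2 * m <= n /\ m <= n)%N by split=> [|m]; lia.
move=> cp p0 pR2 eps0 eps1 nd dp.
have nR : 0 < n%:R :> R by rewrite ltr0n ltnW.
have pR : 0 < p%:R :> R by rewrite ltr0n.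
have h2 : (0 < n./2)%N by rewrite half_gt0.
have ieps : 1 <= eps^-1 by rewrite invf_ge1.
have [m [/andP[m0 mn] me mlow]] := nat_below h2 ieps.
have mR : 0 < m%:R :> R by rewrite ltr0n.
have [m2n mn'] := half_le _ mn.
have epsm : eps * m%:R <= 1 by rewrite -ler_pdivlMl ?mulr1.
have cpp : 128 * (c * p%:R ^+ 2) <= 1.
  apply: le_trans cp; rewrite mulrCA ler_pM2l // ler_pM2l //.
  by rewrite lerXn2r ?nnegrE // ?ltW // (lt_le_trans pR).
apply: (three_point_bound p0 m0) dp => //.
- exact: ltW.
- by rewrite -mulr_natr.
- by apply: le_trans nd; rewrite ler_wpM2r // ler_nat.
have -> : 2^-1 * n%:R * (m%:R / (n%:R * Num.sqrt p%:R)) ^+ 2 =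
    m%:R ^+ 2 / (2 * n%:R * p%:R) :> R.
  have e : p%:R = Num.sqrt p%:R ^+ 2 :> R by rewrite sqr_sqrtr // ltW.
  rewrite [in RHS]e; field; rewrite !gt_eqF ?sqrtr_gt0 //.
rewrite ler_pdivlMr ?mulr_gt0 //.
case: mlow => ml.
  have nm : n%:R <= 8 * m%:R :> R.
    have : n%:R <= 4 * n./2%:R :> R by rewrite -natrM ler_nat.
    by lra.
  apply: (@le_trans _ _ (c * n%:R * (2 * n%:R * p%:R))).
    by rewrite ler_wpM2r ?mulr_ge0 ?(ltW nR) ?(ltW pR) // ler_wpM2l ?(ltW c0) //
      ge_min lexx.
  have n2 := ler_pM (ltW nR) (ltW nR) nm nm.
  have p1 : 1 <= p%:R :> R by rewrite ler1n.
  have cp1 : 128 * (c * p%:R) <= 1.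
    apply: le_trans cpp; rewrite ler_pM2l // ler_pM2l // -[leLHS]mulr1 expr2.
    by rewrite ler_pM2l.
  have cp1' : 0 <= 128 * (c * p%:R) by rewrite !mulr_ge0 // ltW.
  by have := ler_pM (mulr_ge0 (ltW nR) (ltW nR)) cp1' n2 cp1; lra.
apply: (@le_trans _ _ (c * (p%:R / (eps ^+ 2 * n%:R)) * (2 * n%:R * p%:R))).
  by rewrite ler_wpM2r ?mulr_ge0 ?(ltW nR) ?(ltW pR) // ler_wpM2l ?(ltW c0) //
    ge_min lexx orbT.
have -> : c * (p%:R / (eps ^+ 2 * n%:R)) * (2 * n%:R * p%:R) =
    2 * (c * p%:R ^+ 2) * (eps^-1 * eps^-1).
  by field; rewrite !gt_eqF.
have i0 : 0 <= eps^-1 by lra.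
have e2 := ler_pM i0 i0 ml ml.
have cp0 : 0 <= 128 * (c * p%:R ^+ 2) by rewrite !mulr_ge0 ?sqr_ge0 // ltW.
have := ler_pM cp0 (mulr_ge0 i0 i0) cpp e2.
have := sqr_ge0 (m%:R : R); lra.
Qed.

(** Take m about min(n, max(1, 1 / eps)) and k about min(n / m, max(1, w / max(1, eps))); two losses
    of a factor 2 give the factor 4. *)
Lemma group_sizes (R : realType) (n : nat) (eps w : R) :
  (0 < n)%N -> 0 < eps -> 0 < w ->
  exists m k : nat,
    [/\ [/\ (0 < m)%N, (0 < k)%N & (k * m <= n)%N],
        eps *+ m <= Num.max 1 eps, eps *+ m.-1 <= 1,
        k%:R <= Num.max 1 (w / Num.max 1 eps) &
        n%:R <= 4 * (k * m)%:R :> R \/ w / eps <= 4 * (k * m)%:R].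
Proof.
move=> n0 eps0 w0; set eps' := Num.max 1 eps.
have eps'0 : 0 < eps' by rewrite lt_max ltr01.
have x1 : 1 <= Num.max 1 eps^-1 by rewrite le_max lexx.
have x2 : 1 <= Num.max 1 (w / eps') by rewrite le_max lexx.
have [m [/andP[m0 mn] me mlow]] := nat_below n0 x1.
have q0 : (0 < n %/ m)%N by rewrite divn_gt0.
have [k [/andP[k0 kn] ke klow]] := nat_below q0 x2.
have mR : 0 <= m%:R :> R by [].
have eV : eps * eps^-1 = 1 by rewrite mulfV // gt_eqF.
exists m, k; split=> //; first by split; rewrite // -leq_divRL.
- rewrite -mulr_natr; apply: le_trans (ler_wpM2l (ltW eps0) me) _.
  by rewrite /eps'; case: (lerP 1 eps^-1) => _;
    rewrite ?eV ?mulr1 le_max lexx ?orbT.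
(* If m > 1 then m <= 1 / eps; if m = 1, as for large eps, the exponent is 0. *)
- have [m1|m1] := leqP m 1.
    by rewrite (_ : m.-1 = 0%N) //; apply/eqP; rewrite -subn1 subn_eq0.
  have mi : m%:R <= eps^-1.
    move: me; case: (lerP 1 eps^-1) => // _ /(lt_le_trans _) h.
    by have := h 1; rewrite ltr1n => /(_ m1); rewrite ltxx.
  rewrite -mulr_natr -[leRHS]eV; apply: le_trans (ler_wpM2l (ltW eps0) mi).
  by rewrite ler_wpM2l ?(ltW eps0) // ler_nat leq_pred.
rewrite natrM; case: klow => kl.
  left; have qn : n%:R <= 2 * ((n %/ m)%:R * m%:R) :> R.
    rewrite -!natrM ler_nat {1}(divn_eq n m) mul2n -addnn leq_add2l.
    by rewrite (leq_trans (ltnW (ltn_pmod n m0))) // leq_pmull.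
  apply: le_trans qn _; have := ler_wpM2r mR kl; clear; lra.
case: mlow => ml.
  have mk : m%:R <= k%:R * m%:R :> R by rewrite ler_peMl // ler1n.
  by left; move: ml mk mR; clear; lra.
right; have mM : eps' / eps <= 2 * m%:R.
  apply: le_trans ml; rewrite /eps'.
  case: (lerP 1 eps) => h; last by rewrite mul1r le_max lexx orbT.
  by rewrite mulfV ?gt_eqF // le_max lexx.
have kM : w / eps' <= 2 * k%:R.
  by apply: le_trans kl; rewrite le_max lexx orbT.
have := ler_pM (divr_ge0 (ltW w0) (ltW eps'0)) (divr_ge0 (ltW eps'0) (ltW eps0))
  kM mM.
rewrite mulrA divfK ?gt_eqF //; clear; lra.
Qed.

(** Here x stands for k m. The right side equals x^2 / (2 * 36^2 n), and 240 = 4 * 60 comes from the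
    second alternative. *)
Lemma accuracy_threshold_le (R : realType) (c n p eps x : R) :
  0 < c -> c * (2 * 36 ^+ 2 * 240 ^+ 2) <= 1 -> 0 < n -> 0 < p -> 0 < eps ->
  n <= 4 * x \/ Num.sqrt p / 60 / eps <= 4 * x ->
  c * Num.min n (p / (eps ^+ 2 * n)) <= 2^-1 * n * ((x / n) ^+ 2 / 36 ^+ 2).
Proof.
move=> c0 cs n0 p0 eps0 km.
set w := Num.sqrt p in km.
have w0 : 0 < w by rewrite sqrtr_gt0.
have w2 : w ^+ 2 = p by rewrite sqr_sqrtr // ltW.
have -> : 2^-1 * n * ((x / n) ^+ 2 / 36 ^+ 2) = x ^+ 2 / ((2 * 36 ^+ 2) * n).
  by field; rewrite gt_eqF.
have k0 : 0 < (2 * 36 ^+ 2) * n by rewrite !mulr_gt0 ?exprn_gt0.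
rewrite ler_pdivlMr //.
have X0 := sqr_ge0 x.
have cX : (c * ((2 * 36 ^+ 2) * 240 ^+ 2)) * x ^+ 2 <= 1 * x ^+ 2.
  by rewrite ler_wpM2r.
have cX0 := mulr_ge0 (ltW c0) X0.
case: km => km.
  apply: (@le_trans _ _ (c * n * ((2 * 36 ^+ 2) * n))).
    by rewrite ler_pM2r // ler_pM2l // ge_min lexx.
  have := ler_wpM2l (ltW c0) (ler_pM (ltW n0) (ltW n0) km km).
  by move: cX cX0; clear; lra.
apply: (@le_trans _ _ (c * (p / (eps ^+ 2 * n)) * ((2 * 36 ^+ 2) * n))).
  by rewrite ler_pM2r // ler_pM2l // ge_min lexx orbT.
have h1 : 0 <= w / 60 / eps by rewrite !divr_ge0 // ltW.
have := ler_wpM2l (ltW c0) (ler_pM h1 h1 km km).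
have -> : c * (w / 60 / eps * (w / 60 / eps)) =
    c * (p / eps ^+ 2) / 60 ^+ 2 by rewrite -w2; field; rewrite gt_eqF.
have -> : c * (p / (eps ^+ 2 * n)) * ((2 * 36 ^+ 2) * n) =
    (2 * 36 ^+ 2) * (c * (p / eps ^+ 2)) by field; rewrite !gt_eqF.
by move: cX cX0; clear; lra.
Qed.

(* With this bound on k, the term 10 k sqrt(e p) of
   [private_fingerprinting_bound] is at most p / 6. *)
Lemma few_groups (R : realType) (k e p : R) :
  0 <= k -> 1 <= e -> 60 ^+ 2 * e <= p ->
  k <= Num.max 1 (Num.sqrt p / 60 / e) ->
  60 * (k * Num.sqrt (e * p)) <= p.
Proof.
move=> k0 e1 ep ke; have e0 : 0 < e by lra.
have p0 : 0 < p by apply: lt_le_trans ep; rewrite mulr_gt0 // exprn_gt0.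
have w2 : Num.sqrt p ^+ 2 = p by rewrite sqr_sqrtr // ltW.
have ep0 : 0 <= e * p by rewrite mulr_ge0 // ltW.
rewrite -ler_sqr ?nnegrE ?(ltW p0) //; last by rewrite !mulr_ge0 ?sqrtr_ge0.
rewrite !exprMn sqr_sqrtr //.
suff h : 60 ^+ 2 * (k ^+ 2 * e) <= p.
  by have := ler_wpM2r (ltW p0) h; clear; lra.
have [k1|k1] := lerP k 1.
  apply: le_trans ep; rewrite ler_pM2l ?exprn_gt0 //.
  by rewrite ler_piMl ?(ltW e0) // exprn_ile1.
have kw : k <= Num.sqrt p / 60 / e.
  by move: ke; rewrite le_max leNgt k1.
move: kw; rewrite ler_pdivlMr // ler_pdivlMr // => kw.
have t0 : 0 <= k * e * 60 by rewrite !mulr_ge0 // ltW.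
have := ler_pM t0 t0 kw kw; rewrite -!expr2 w2.
have := ler_wpM2l (sqr_ge0 k) (ler_wpM2l (ltW e0) e1).
by clear; lra.
Qed.

(** The fingerprinting bound would give p / 3 <= p / 6 + (32/5) p / 100, which is false. *)
Lemma not_close_high_dimension (R : realType) (c : R) n p (eps delta : R)
    (A : algorithm R p) :
  0 < c -> c * (2 * 36 ^+ 2 * 240 ^+ 2) <= 1 ->
  (0 < n)%N -> 60 ^+ 2 <= p%:R :> R ->
  0 < eps -> eps <= Num.max 1 (c * p%:R) ->
  n%:R * `|delta| <= 1 / 100 -> differentially_private n eps delta A ->
  ~ close_whp n (c * Num.min n%:R (p%:R / (eps ^+ 2 * n%:R))) A.
Proof.
move=> c0 cs n0 p60 eps0 epsle nd dp cw.
have nR : 0 < n%:R :> R by rewrite ltr0n.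
have pR : 0 < p%:R :> R by apply: lt_le_trans p60; rewrite exprn_gt0.
set eps' := Num.max 1 eps.
have e1 : 1 <= eps' by rewrite le_max lexx.
have ep : 60 ^+ 2 * eps' <= p%:R.
  have cp : 60 ^+ 2 * (c * p%:R) <= p%:R.
    rewrite mulrA -[leRHS]mul1r ler_pM2r //; move: c0 cs; clear; lra.
  rewrite /eps'; case: (lerP 1 eps) => h; last by rewrite mulr1.
  apply: (@le_trans _ _ (60 ^+ 2 * Num.max 1 (c * p%:R))).
    by rewrite ler_pM2l ?exprn_gt0.
  by case: (lerP 1 (c * p%:R)) => _; rewrite ?mulr1.
have w0 : 0 < Num.sqrt p%:R / 60 :> R by rewrite divr_gt0 // sqrtr_gt0.
have [m [k [[m0 k0 kmn] epsm epsm1 ke km]]] := group_sizes n0 eps0 w0.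
have tle := accuracy_threshold_le c0 cs nR pR eps0 km.
have ep16 : 16 * eps' <= p%:R by move: ep e1; clear; lra.
have := private_fingerprinting_bound k0 m0 kmn (ltW eps0) epsm epsm1 e1 ep16
  tle dp cw.
have kd : k%:R * (m%:R * `|delta|) <= 1 / 100.
  by rewrite mulrA -natrM (le_trans _ nd) // ler_wpM2r // ler_nat.
have := few_groups (ler0n R k) e1 ep ke.
have := ler_wpM2l (ltW pR) kd.
by move: pR; rewrite -/eps'; clear; lra.
Qed.

(* Without the upper bound on eps the claim fails: for p = 1 and eps = 10, the
   truncated geometric mechanism on the number of positive entries is
   (10, 0)-differentially private and returns the exact mean with probability
   above 2/3, for every n. *)
Theorem theorem5p5 (R : realType) :
  exists2 c : R, 0 < c &
  forall delta : nat -> R, (fun n : nat => n%:R * delta n) @ \oo --> (0 : R) ->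
  exists N : nat, forall n : nat, (N <= n)%N ->
  forall p : nat, (0 < p)%N ->
  forall eps : R, 0 < eps -> eps <= Num.max 1 (c * p%:R) ->
  forall A : algorithm R p,
  differentially_private n eps (delta n) A ->
  (forall D : {mset 'rV[R]_p}, dataset n D -> A D (@unit_ball2 R p) = 1%E) ->
  exists D : {mset 'rV[R]_p}, dataset n D /\
    ((1 / 3)%:E <=
     A D [set theta : 'rV[R]_p |
            (c * Num.min n%:R (p%:R / (eps ^+ 2 * n%:R)) <=
             loss D theta - loss D (mean D))%R])%E.
Proof.
(* The inverse of c must be at least 2 * 36^2 * 240^2, about 1.5 * 10^8, and 128 * 60^4, about 1.7 *
   10^9. *)
pose c : R := (100 ^+ 5)^-1.
have c0 : 0 < c by rewrite invr_gt0 exprn_gt0.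
have ch : c * (2 * 36 ^+ 2 * 240 ^+ 2) <= 1.
  by rewrite mulrC ler_pdivrMr ?exprn_gt0 // mul1r; clear; lra.
have cl : c * (128 * (60 ^+ 2) ^+ 2) <= 1.
  by rewrite mulrC ler_pdivrMr ?exprn_gt0 // mul1r; clear; lra.
exists c => // delta dlim.
have e0 : 0 < 1 / 100 :> R by lra.
move/cvgr0Pnorm_le: dlim => /(_ _ e0) [N _ HN].
exists (maxn 2 N) => n; rewrite geq_max => /andP[n2 nN].
move=> p p0 eps eps0 epsle A dp _.
have nd : n%:R * `|delta n| <= 1 / 100.
  by have := HN n nN; rewrite /= normrM normr_nat.
apply: contrapT => /(close_whp_of_no_bad_dataset (ltnW n2)) cw.
(* In dimension at most 60^2 one has c p <= 1, so the bound on eps reduces to eps <= 1. *)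
have [p60|p60] := lerP p%:R (60 ^+ 2 : R).
  apply: (not_close_low_dimension c0 cl n2 p0 p60 eps0 _ nd dp cw).
  apply: le_trans epsle _; rewrite ge_max lexx /=.
  apply: le_trans cl; rewrite ler_pM2l //; apply: le_trans p60 _.
  by clear; lra.
exact: (not_close_high_dimension c0 ch (ltnW n2) (ltW p60) eps0 epsle nd dp cw).
Qed.
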